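(* Let $k$ be a field with $\operatorname{char}(k) \neq 2$ and let $C \colon y^2 = f(x)$ be a hyperelliptic curve of genus $g$ over $k$ such that $f \in k[x]$ is monic of odd degree $2g+1$. Let $\infty$ be the unique point at infinity on $C$, let $J$ be the Jacobian variety of $C$, and let $i \colon C \to J$, $P \mapsto [P - \infty]$, be the embedding defined by $\infty$. (1) If $P \in C(k) \setminus \{\infty\}$ is such that $i(P) \in J(k)$ has finite order $n$, then $n = 2$ or $n \ge 2g+1$. (2) If $P \in C(k)$ is such that $i(P)$ has order $2g+1$ and $x(P) = 0$, then $f = x^{2g+1} + h(x)^2$ with a polynomial $h \in k[x]$ of degree $\le g$ such that $P = (0, h(0))$. Conversely, if $f$ is of this form and $P = (0, h(0))$, then $i(P)$ has order $2g+1$.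
   Context: $C$ denotes the smooth projective model of the affine curve $y^2 = f(x)$, where $f$ is squarefree (so that $C$ has genus $g$). *)

(* Defs.v *)
From HB Require Import structures.
From mathcomp Require Import all_boot all_order all_algebra all_field.
From mathcomp Require Import boolp.
From mathcomp Require Import freeg.

Set Implicit Arguments.
Unset Strict Implicit.
Unset Printing Implicit Defensive.

Import GRing.Theory.
Local Open Scope ring_scope.
Local Open Scope quotient_scope.

(* [separable_poly f] says that f is squarefree over every extension of k. This
   is what smoothness of the model (equivalently, genus g over the algebraic
   closure of k) requires; for perfect k it is the same as f being squarefree
   in k[x]. *)
Record hyperelliptic (k : fieldType) (g : nat) := Hyperelliptic {
  hpoly : {poly k};
  hpoly_char : 2%N \notin [pchar k];
  hpoly_monic : hpoly \is monic;
  hpoly_size : size hpoly = (2 * g + 1).+1;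
  hpoly_separable : separable_poly hpoly }.

Section Curve.
Variables (k : fieldType) (g : nat) (C : hyperelliptic k g).

Definition affine_point : choiceType :=
  {p : k * k | p.2 ^+ 2 == (hpoly C).[p.1]}.

Definition point : choiceType := option affine_point.
Definition infinity : point := None.
Definition affine (Q : affine_point) : point := Some Q.

Definition defining_poly : {poly {fraction {poly k}}} :=
  'X^2 - (FracField.tofrac (hpoly C))%:P.

Fact defining_poly_irreducible : monic_irreducible_poly defining_poly.
Proof.
have small (c : {fraction {poly k}}) :
    (size (- c%:P) < size ('X^2 : {poly {fraction {poly k}}}))%N.
  by rewrite size_polyXn size_polyN ltnS (leq_trans (size_polyC_leq1 _)).
have sz : size defining_poly = 3%N.
  by rewrite size_polyDl ?small ?size_polyXn.
split; last by rewrite monicE lead_coefDl ?lead_coefXn ?small.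
apply: cubic_irreducible; first by rewrite sz.
move=> z; apply/negP.
rewrite /root /defining_poly !hornerE subr_eq0 => /eqP z2.
have [n [d [d0 zd]]] : exists n d : {poly k},
    d != 0 /\ z * FracField.tofrac d = FracField.tofrac n.
  exists \n_(repr z), \d_(repr z); split; first exact: denom_ratioP.
  apply/eqP; rewrite -{1}[z]reprK; unlock FracField.tofrac.
  rewrite -[_ * _]FracField.pi_mul piE /= FracField.equivfE /FracField.mulf.
  rewrite !numden_Ratio ?mulf_neq0 ?oner_neq0 ?denom_ratioP //.
  by rewrite !mulr1 mulrC.
have {z2 zd} : hpoly C * d ^+ 2 = n ^+ 2.
  by apply/eqP; rewrite -tofrac_eq rmorphM !rmorphXn /= -zd exprMn z2.
have C0 : hpoly C != 0 by rewrite -size_poly_eq0 hpoly_size.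
move=> E; have n0 : n != 0.
  by have := mulf_neq0 C0 (expf_neq0 2 d0); rewrite E expf_eq0.
move: (congr1 (fun p : {poly k} => size p) E).
rewrite size_mul ?expf_neq0 // hpoly_size !expr2 !size_mul //.
move: d0 n0; rewrite -!size_poly_gt0.
case: (size d) (size n) => [|sd] [|sn] // _ _.
rewrite !(addnS, addSn) /= => /(congr1 odd).
by rewrite !oddS addn0 mul2n !addnn -doubleD !odd_double.
Qed.

Definition function_field : fieldType :=
  {poly %/ defining_poly with defining_poly_irreducible}.

Definition constF : k -> function_field :=
  in_alg function_field \o @FracField.tofrac {poly k} \o polyC.
HB.instance Definition _ := GRing.RMorphism.on constF.

Definition xF : function_field := in_alg function_field (FracField.tofrac 'X).
Definition yF : function_field := 'qX.

(* The smooth projective model is glued from the affine charts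
     y ^ 2 = f(x)   and   v ^ 2 = u ^ (2g+2) f(1/u),
   where u = 1/x and v = y / x ^ (g+1); the only point of the second chart with
   u = 0 is (0, 0), the point at infinity. [chart P] gives the two coordinate
   functions of a chart around P and the coordinates of P in that chart. *)
Definition chart (P : point) :
    (function_field * function_field) * (k * k) :=
  if P is Some Q then ((xF, yF), val Q)
  else ((xF^-1, yF / xF ^+ g.+1), (0, 0)).

Definition eval_fun (P : point) (A : {poly {poly k}}) : function_field :=
  let: (s, t) := (chart P).1 in (map_poly (map_poly constF) A).[s, t].

Definition eval_at (P : point) (A : {poly {poly k}}) : k :=
  let: (a, b) := (chart P).2 in A.[a, b].

(* phi lies in the local ring of the curve at P and takes the value c there. *)
Definition has_value (P : point) (phi : function_field) (c : k) : Prop :=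
  exists A B : {poly {poly k}},
    [/\ eval_at P B != 0, phi = eval_fun P A / eval_fun P B
      & c = eval_at P A / eval_at P B].

Definition local_ring (P : point) (phi : function_field) : Prop :=
  exists c, has_value P phi c.
Definition local_ideal (P : point) (phi : function_field) : Prop :=
  has_value P phi 0.
Definition local_unit (P : point) (phi : function_field) : Prop :=
  exists2 c, c != 0 & has_value P phi c.

Definition uniformizer (P : point) (t : function_field) : Prop :=
  forall phi, local_ideal P phi <-> exists2 w, local_ring P w & phi = t * w.

(* Every point is smooth, so uniformizers exist, and any two of them differ by
   a unit of the local ring: for phi != 0 the integer n exists, is unique and
   does not depend on t. *)
Definition is_order (P : point) (phi : function_field) (n : int) : Prop :=
  forall t, uniformizer P t -> exists2 w, local_unit P w & phi = t ^ n * w.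

Lemma eval_funM P : {morph eval_fun P : A B / A * B}.
Proof.
move=> A B; rewrite /eval_fun; case: (chart P).1 => s t.
by rewrite !rmorphM /= !hornerM.
Qed.

Lemma eval_fun1 P : eval_fun P 1 = 1.
Proof.
rewrite /eval_fun; case: (chart P).1 => s t.
by rewrite rmorph1 !hornerC.
Qed.

Lemma eval_atM P : {morph eval_at P : A B / A * B}.
Proof.
by move=> A B; rewrite /eval_at; case: (chart P).2 => a b; rewrite !hornerM.
Qed.

Lemma eval_at1 P : eval_at P 1 = 1.
Proof. by rewrite /eval_at; case: (chart P).2 => a b; rewrite !hornerC. Qed.

Lemma local_unit1 P : local_unit P 1.
Proof.
exists 1; first exact: oner_neq0.
by exists 1, 1; rewrite eval_fun1 eval_at1 !divr1 oner_neq0.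
Qed.

Lemma local_unit_div P phi psi :
  local_unit P phi -> local_unit P psi -> local_unit P (phi / psi).
Proof.
move=> [c c0 [A [B [B0 -> cE]]]] [d d0 [A' [B' [B'0 -> dE]]]].
have A'0 : eval_at P A' != 0 by apply: contraNneq d0 => e; rewrite dE e mul0r.
exists (c / d); first by rewrite mulf_neq0 ?invr_eq0.
exists (A * B'), (B * A'); rewrite !eval_funM !eval_atM mulf_neq0 //.
by split=> //; rewrite ?cE ?dE invf_div mulf_div.
Qed.

End Curve.

Section Jacobian.
Variables (K : closedFieldType) (g : nat) (C : hyperelliptic K g).

Definition divisor : zmodType := {freeg (point C) / int}.

Definition degree0 : {pred divisor} := fun D => deg D == 0.
Fact degree0_zmod_closed : zmod_closed degree0.
Proof.
split=> [|D E]; rewrite !unfold_in ?deg0 // => /eqP D0 /eqP E0.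
by rewrite degB D0 E0.
Qed.
HB.instance Definition _ := GRing.isZmodClosed.Build divisor degree0
  degree0_zmod_closed.

Record divisor0 := Divisor0 {
  divisor0_val :> divisor;
  divisor0P : divisor0_val \in degree0 }.
HB.instance Definition _ := [isSub for divisor0_val].
HB.instance Definition _ := [Choice of divisor0 by <:].
HB.instance Definition _ := [SubChoice_isSubZmodule of divisor0 by <:].

Definition principal : {pred divisor0} := fun D =>
  `[< exists2 phi : function_field C, phi != 0 &
        forall P, is_order P phi (coeff P (val D)) >].
Fact principal_zmod_closed : zmod_closed principal.
Proof.
split=> [|D E].
  apply/asboolP; exists 1; first exact: oner_neq0.
  move=> P t _; exists 1; first exact: local_unit1.
  by rewrite /= coeff0 expr0z mulr1.
move=> /asboolP[phi phi0 phiD] /asboolP[psi psi0 psiE].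
apply/asboolP; exists (phi / psi); first by rewrite mulf_neq0 ?invr_eq0.
move=> P t ut; rewrite /= coeffB.
have [w uw phiE] := phiD P t ut; have [v uv psiEv] := psiE P t ut.
exists (w / v); first exact: local_unit_div.
have [t0|t0] := eqVneq t 0; last first.
  by rewrite phiE psiEv invfM mulrACA expfzDr // invr_expz.
move: phiE psiEv phi0 psi0; rewrite t0 !exp0rz.
do 2!case: eqP => [->|_]; rewrite ?mul0r; try by move=> -> ->; rewrite ?eqxx.
by move=> -> -> _ _; rewrite subrr eqxx !mul1r.
Qed.
HB.instance Definition _ := GRing.isZmodClosed.Build divisor0 principal
  principal_zmod_closed.

(* The group J(K) = Pic^0(C) of K-points of the Jacobian variety; closedness of
   K makes the points of [point C] all the closed points of the curve, each of
   degree one. *)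
Definition jacobian : zmodType := Quotient.quot principal.

Fact pt_sub_infinity_degree0 (P : point C) :
  (<< P >> - << infinity C >> : divisor) \in degree0.
Proof. by rewrite unfold_in degB !degU. Qed.

Definition abel_jacobi (P : point C) : jacobian :=
  \pi_jacobian (Divisor0 (pt_sub_infinity_degree0 P)).

End Jacobian.

Section BaseChange.
Variables (k K : fieldType) (iota : {rmorphism k -> K}).
Variables (g : nat) (C : hyperelliptic k g).

Program Definition base_change : hyperelliptic K g :=
  @Hyperelliptic K g (map_poly iota (hpoly C)) _ _ _ _.
Next Obligation. by rewrite (fmorph_pchar iota) (hpoly_char C). Qed.
Next Obligation. by rewrite map_monic (hpoly_monic C). Qed.
Next Obligation. by rewrite size_map_poly (hpoly_size C). Qed.
Next Obligation. by rewrite separable_map (hpoly_separable C). Qed.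

Fact base_change_point_subproof (Q : affine_point C) :
  (iota (val Q).2) ^+ 2 == (hpoly base_change).[iota (val Q).1].
Proof. by rewrite /= horner_map -rmorphXn (eqP (valP Q)). Qed.

Definition base_change_point (P : point C) : point base_change :=
  if P is Some Q then
    affine (exist _ (iota (val Q).1, iota (val Q).2)
                    (base_change_point_subproof Q) : affine_point base_change)
  else infinity base_change.

End BaseChange.

Definition has_order (G : zmodType) (z : G) (n : nat) : Prop :=
  [/\ (0 < n)%N, z *+ n = 0 & forall m, (0 < m)%N -> z *+ m = 0 -> (n <= m)%N].

(* Main.v *)
(** A function with divisor [n P - n oo] is regular on the affine curve, hence
    of the form [a(x) + b(x) y], and [a] and [b y] have poles at infinity of the
    distinct orders [2 deg a] and [2 deg b + 2g + 1]. If [n < 2g + 1], then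
    [b = 0]; as [a] vanishes only at [P], the point [P] is its own conjugate, so
    [y(P) = 0] and [2 P ~ 2 oo]. If [n = 2g + 1], then up to a scalar the
    function is [y - h(x)] with [deg h <= g], and every root [r] of the monic
    polynomial [f - h^2] gives a zero [(r, h(r))], so that 0 is the only root.
    Separability of [f] makes [2 h(0)] nonzero when [g > 0], so the coefficients
    of [h] can be solved for successively in the ground field. Conversely,
    [y - h] has divisor [(2g + 1) (P - oo)] because
    [(y - h)(y + h) = x^(2g + 1)]. *)

Require Import Defs.
From HB Require Import structures.
From mathcomp Require Import all_boot all_order all_algebra all_field.
From mathcomp Require Import freeg boolp ring zify.

Set Implicit Arguments.
Unset Strict Implicit.
Unset Printing Implicit Defensive.

Import GRing.Theory.
Local Open Scope ring_scope.

(** * Polynomials of degree at most one *)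

Section LinearPolynomials.
Variable R : nzRingType.
Implicit Type p : {poly R}.

Lemma linear_poly_eq0 (r s : R) : r%:P + s *: 'X = 0 -> r = 0 /\ s = 0.
Proof.
move=> /polyP e; move: (e 0) (e 1).
rewrite !coefD !coefZ !coefC !coefX /=.
by rewrite mulr0 mulr1 addr0 add0r.
Qed.

Lemma linear_polyE p : (size p <= 2)%N -> p = (p`_0)%:P + p`_1 *: 'X.
Proof.
move=> szp; apply/polyP => -[|[|i]];
  rewrite coefD coefZ coefC coefX /= ?(mulr0, mulr1, addr0, add0r) //.
by rewrite nth_default // (leq_trans szp).
Qed.

End LinearPolynomials.

(** * The function field as a quadratic extension of [k(x)] with basis [1], [y] *)

Section FunctionField.
Variables (k : fieldType) (g : nat) (C : hyperelliptic k g).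
Local Notation F := (function_field C).
Local Notation f := (hpoly C).
Local Notation x := (xF C).
Local Notation y := (yF C).

(** Written as a composite of ring morphisms so that it inherits their structure. The argument [s]
    is [x] in the affine chart and [x^-1] in the chart at infinity. *)
Definition ev (s : F) : {poly k} -> F := horner_eval s \o map_poly (constF C).
HB.instance Definition _ s := GRing.RMorphism.on (ev s).

Lemma evC s c : ev s c%:P = constF C c.
Proof. by rewrite /ev /= map_polyC /horner_eval hornerC. Qed.

Lemma evX s : ev s 'X = s.
Proof. by rewrite /ev /= map_polyX /horner_eval hornerX. Qed.

Lemma ev_xFE a : ev x a = in_alg F (FracField.tofrac a).
Proof.
rewrite /ev /= /constF map_poly_comp /= /horner_eval /xF.
rewrite map_poly_comp horner_map /= horner_map /=.
by rewrite -/(comp_poly 'X a) comp_polyXr.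
Qed.

Lemma defining_poly_size : size (defining_poly C) = 3%N.
Proof.
rewrite size_polyDl size_polyXn // size_polyN.
by rewrite (leq_ltn_trans (size_polyC_leq1 _)).
Qed.

Lemma qpoly_basis (r s : {fraction {poly k}}) :
  in_alg F r + in_alg F s * y
    = in_qpoly (defining_poly C) (r%:P + s *: 'X).
Proof.
have -> : in_alg F r + in_alg F s * y = r *: (1 : F) + s *: y.
  by rewrite -[in RHS](mulr_algl s y).
by rewrite -alg_polyC in_qpolyD !in_qpolyZ in_qpoly1.
Qed.

(** The quotient reduces modulo [mk_monic], which falls back to ['X] when the modulus is constant or
    not monic; neither happens here. *)
Lemma mk_defining_poly : mk_monic (defining_poly C) = defining_poly C.
Proof.
rewrite /mk_monic defining_poly_size.
by case: (defining_poly_irreducible C) => _ ->.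
Qed.

Lemma polyn_basis (r s : {fraction {poly k}}) :
  polyn (in_qpoly (defining_poly C) (r%:P + s *: 'X)) = r%:P + s *: 'X.
Proof.
apply: in_qpoly_small; rewrite mk_defining_poly defining_poly_size ltnS.
rewrite (leq_trans (size_polyD _ _)) // geq_max.
rewrite (leq_trans (size_polyC_leq1 _)) //.
by rewrite (leq_trans (size_scale_leq _ _)) ?size_polyX.
Qed.

(** Reduction leaves a representative of degree at most 1 unchanged, so a zero class has zero
    coefficients. *)
Lemma basis_free (r s : {fraction {poly k}}) :
  in_alg F r + in_alg F s * y = 0 -> r = 0 /\ s = 0.
Proof.
rewrite qpoly_basis => e.
by apply: linear_poly_eq0; rewrite -polyn_basis e.
Qed.

Lemma basis_span (phi : F) :
  exists r s : {fraction {poly k}}, phi = in_alg F r + in_alg F s * y.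
Proof.
exists (polyn phi)`_0, (polyn phi)`_1; rewrite qpoly_basis.
apply: val_inj; rewrite [RHS]polyn_basis.
have szphi : (size (polyn phi) <= 2)%N.
  have := size_mk_monic phi.
  by rewrite [X in (_ < size (polyseq X))%N]mk_defining_poly defining_poly_size.
exact: linear_polyE.
Qed.

Lemma yF_sqr : y ^+ 2 = ev x f.
Proof.
(* A zero multiple of [y] brings the right side into the shape of [qpoly_basis]; the difference of
   the two sides is then the class of [defining_poly] itself. *)
rewrite ev_xFE -[in_alg _ _]addr0 -(mul0r y) -[0 in RHS](rmorph0 (in_alg F)).
rewrite qpoly_basis scale0r addr0 /yF.
have -> : ('qX : F) ^+ 2 = in_qpoly (defining_poly C) ('X ^+ 2).
  by rewrite rmorphXn.
apply/eqP; rewrite -subr_eq0 -rmorphB; apply/eqP/val_inj => /=.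
rewrite mk_defining_poly; apply: Pdiv.RingMonic.rmodpp.
by case: (defining_poly_irreducible C).
Qed.

Lemma ev_basis_free a b : ev x a + ev x b * y = 0 -> a = 0 /\ b = 0.
Proof.
rewrite !ev_xFE => /basis_free[/eqP + /eqP].
by rewrite !tofrac_eq0 => /eqP-> /eqP->.
Qed.

Lemma ev_xF_eq0 a : (ev x a == 0) = (a == 0).
Proof.
apply/eqP/eqP => [e|->]; last by rewrite rmorph0.
by have [] := @ev_basis_free a 0; rewrite // e rmorph0 mul0r addr0.
Qed.

(** The product of the denominators of the two coordinates of [phi] serves as [d]. *)
Lemma common_denominator (phi : F) :
  exists d a b : {poly k}, d != 0 /\ phi * ev x d = ev x a + ev x b * y.
Proof.
have frac (z : {fraction {poly k}}) : exists d n : {poly k},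
    d != 0 /\ z * FracField.tofrac d = FracField.tofrac n.
  exists \d_(repr z), \n_(repr z); split; first exact: denom_ratioP.
  apply/eqP; rewrite -{1}[z]reprK; unlock FracField.tofrac.
  rewrite -[_ * _]FracField.pi_mul piE /= FracField.equivfE /FracField.mulf.
  rewrite !numden_Ratio ?mulf_neq0 ?oner_neq0 ?denom_ratioP //.
  by rewrite !mulr1 mulrC.
have [r [s ->]] := basis_span phi.
have [d [n [d0 dn]]] := frac r; have [e [m [e0 em]]] := frac s.
exists (d * e), (n * e), (m * d); split; first by rewrite mulf_neq0.
have dnF : in_alg F r * ev x d = ev x n by rewrite !ev_xFE -rmorphM dn.
have emF : in_alg F s * ev x e = ev x m by rewrite !ev_xFE -rmorphM em.
rewrite [ev x (d * e)]rmorphM [ev x (n * e)]rmorphM [ev x (m * d)]rmorphM /=.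
rewrite -dnF -emF mulrDl mulrA; congr (_ + _).
by rewrite mulrAC [ev x d * _]mulrC mulrA.
Qed.

End FunctionField.

(** The reciprocal polynomial [X^d p(1/X)] when [deg p <= d]. Its value at 0 is the coefficient of
    [p] in degree [d]. *)
Definition rev_poly (R : nzRingType) (d : nat) (p : {poly R}) : {poly R} :=
  \poly_(i < d.+1) p`_(d - i).

(** * Reduction modulo the chart equations, and values of functions at a point *)

Section LocalRing.
Variables (k : fieldType) (g : nat) (C : hyperelliptic k g).
Local Notation F := (function_field C).
Local Notation f := (hpoly C).
Local Notation x := (xF C).
Local Notation y := (yF C).
Implicit Types (P : point C) (phi psi : F).

Lemma xF_neq0 : x != 0.
Proof. by rewrite -(evX x) ev_xF_eq0 polyX_eq0. Qed.

Lemma ev_wide n (s : F) (p : {poly k}) : (size p <= n)%N ->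
  ev s p = \sum_(i < n) constF C p`_i * s ^+ i.
Proof.
move=> szp; rewrite /ev /= /horner_eval.
rewrite (horner_coef_wide (n := n)) ?size_map_poly //.
by apply: eq_bigr => i _; rewrite coef_map.
Qed.

Lemma ev_rev_poly (s : F) d (p : {poly k}) : s != 0 -> (size p <= d.+1)%N ->
  ev s p = s ^+ d * ev s^-1 (rev_poly d p).
Proof.
move=> s0 szp; rewrite (ev_wide _ szp) (ev_wide _ (size_poly _ _)).
rewrite (reindex_inj rev_ord_inj) mulr_sumr; apply: eq_bigr => i _ /=.
rewrite coef_poly ltn_ord subSS mulrCA; congr (_ * _).
move: (nat_of_ord i) (ltn_ord i : i <= d)%N => j led.
by rewrite -{2}(subnK led) exprD -mulrA -exprMn mulfV // expr1n mulr1.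
Qed.

Lemma eval_funE P A :
  eval_fun P A =
  (map_poly (map_poly (constF C)) A).[(chart P).1.1, (chart P).1.2].
Proof. by rewrite /eval_fun; case: (chart P).1. Qed.

Lemma eval_atE P A : eval_at P A = A.[(chart P).2.1, (chart P).2.2].
Proof. by rewrite /eval_at; case: (chart P).2. Qed.

Lemma eval_fun_zmod P : zmod_morphism (eval_fun P).
Proof. by move=> A B; rewrite !eval_funE rmorphB !hornerE. Qed.
HB.instance Definition _ P :=
  GRing.isZmodMorphism.Build _ _ (eval_fun P) (eval_fun_zmod P).
HB.instance Definition _ P := GRing.isMonoidMorphism.Build _ _ (eval_fun P)
  (eval_fun1 P, eval_funM P).

Lemma eval_at_zmod P : zmod_morphism (eval_at P).
Proof. by move=> A B; rewrite !eval_atE !hornerE. Qed.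
HB.instance Definition _ P :=
  GRing.isZmodMorphism.Build _ _ (eval_at P) (eval_at_zmod P).
HB.instance Definition _ P := GRing.isMonoidMorphism.Build _ _ (eval_at P)
  (eval_at1 P, eval_atM P).

Lemma eval_funC P c : eval_fun P c%:P%:P = constF C c.
Proof. by rewrite eval_funE !map_polyC /= map_polyC /= !hornerC. Qed.
Lemma eval_funX P : eval_fun P 'X = (chart P).1.1.
Proof. by rewrite eval_funE map_polyX hornerX hornerC. Qed.
Lemma eval_funY P : eval_fun P 'Y = (chart P).1.2.
Proof. by rewrite eval_funE map_polyC /= map_polyX hornerC hornerX. Qed.

Lemma eval_atC P c : eval_at P c%:P%:P = c.
Proof. by rewrite eval_atE !hornerC. Qed.
Lemma eval_atX P : eval_at P 'X = (chart P).2.1.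
Proof. by rewrite eval_atE hornerX hornerC. Qed.
Lemma eval_atY P : eval_at P 'Y = (chart P).2.2.
Proof. by rewrite eval_atE hornerC hornerX. Qed.

(** The right side of the chart equation. At infinity it is [u^(2g+2) f(1/u)], with one factor [u]
    split off from the reciprocal of [f]. *)
Definition chart_poly P : {poly k} :=
  if P is Some _ then f else 'X * rev_poly (2 * g + 1) f.

Lemma chart_fun_sqr P : (chart P).1.2 ^+ 2 = ev (chart P).1.1 (chart_poly P).
Proof.
case: P => [Q|] /=; first exact: yF_sqr.
rewrite rmorphM /= evX expr_div_n yF_sqr.
rewrite (@ev_rev_poly _ (2 * g + 1)) ?xF_neq0 ?hpoly_size //.
have -> : x ^+ g.+1 ^+ 2 = x ^+ (2 * g + 1) * x.
  by rewrite -exprM -exprSr; congr (_ ^+ _); lia.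
by rewrite invfM mulrACA mulfV ?expf_neq0 ?xF_neq0 // mul1r mulrC.
Qed.

Lemma chart_at_sqr P : (chart P).2.2 ^+ 2 = (chart_poly P).[(chart P).2.1].
Proof.
case: P => [Q|] /=; first exact/eqP/(valP Q).
by rewrite hornerM hornerX mul0r expr0n.
Qed.

(** The chart equation holds both for the coordinate functions and for the coordinates of [P], so
    one pair [a], [b] reduces both evaluations. *)
Lemma eval_reduce P A : exists a b : {poly k},
  eval_fun P A = ev (chart P).1.1 a + ev (chart P).1.1 b * (chart P).1.2 /\
  eval_at P A = a.[(chart P).2.1] + b.[(chart P).2.1] * (chart P).2.2.
Proof.
pose red A := exists a b : {poly k},
  eval_fun P A = ev (chart P).1.1 a + ev (chart P).1.1 b * (chart P).1.2 /\
  eval_at P A = a.[(chart P).2.1] + b.[(chart P).2.1] * (chart P).2.2.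
have redD A1 A2 : red A1 -> red A2 -> red (A1 + A2).
  move=> [a [b [e1 e2]]] [a' [b' [e1' e2']]]; exists (a + a'), (b + b').
  rewrite !rmorphD /= !hornerD e1 e2 e1' e2'.
  by split; rewrite addrACA -mulrDl.
have redC c : red c%:P%:P.
  exists c%:P, 0; rewrite eval_funC eval_atC rmorph0 evC !hornerC.
  by rewrite !mul0r !addr0.
have redX A1 : red A1 -> red (A1 * 'X).
  move=> [a [b [e1 e2]]]; exists (a * 'X), (b * 'X).
  rewrite !rmorphM /= eval_funX eval_atX evX e1 e2 !hornerM !hornerX.
  by split; rewrite mulrDl [in LHS]mulrAC.
(* Multiplying [a + b t] by [t] gives [b t^2 + a t], and the chart equation replaces [t^2]. *)
have redY A1 : red A1 -> red (A1 * 'Y).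
  move=> [a [b [e1 e2]]]; exists (b * chart_poly P), a.
  rewrite !rmorphM /= eval_funY eval_atY e1 e2 !hornerM.
  rewrite -chart_fun_sqr -chart_at_sqr !mulrDl -!mulrA -!expr2.
  by rewrite !(addrC (_ * _ ^+ 2)).
elim/poly_ind: A => [|A c IH]; first by rewrite -!polyC0; apply: redC.
apply: (redD _ _ (redX _ IH)).
elim/poly_ind: c => [|c d IHc]; first by rewrite -!polyC0; apply: redC.
by rewrite polyCD polyCM; apply: redD; [apply: redY | apply: redC].
Qed.

(** This is what makes the value of a fraction at [P] well defined. In the affine chart both reduced
    coefficients vanish; at infinity only [a(0)] matters, because the second coordinate of the point
    is 0. *)
Lemma eval_ker P A : eval_fun P A = 0 -> eval_at P A = 0.
Proof.
have [a [b [-> ->]]] := eval_reduce P A; case: P => [Q|] /=.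
  by move=> /ev_basis_free[-> ->]; rewrite !horner0 mul0r addr0.
move=> e0; rewrite mulr0 addr0 horner_coef0.
set d := maxn (size a) (size b).
have sza : (size a <= d.+1)%N by rewrite leqW // leq_maxl.
have szb : (size b <= d.+1)%N by rewrite leqW // leq_maxr.
have x0 := xF_neq0; have u0 : x^-1 != 0 by rewrite invr_eq0.
(* Multiplying the relation in [x^-1] by [x^(d + g + 1)] turns it into one between polynomials in
   [x], to which freeness of [1], [y] applies. *)
have : ev x (rev_poly d a * 'X^(g.+1)) + ev x (rev_poly d b) * y = 0.
  rewrite rmorphM rmorphXn /= evX.
  have -> : y = y / x ^+ g.+1 * x ^+ g.+1 by rewrite divfK // expf_neq0.
  rewrite mulrA -mulrDl; apply/eqP.
  rewrite mulf_eq0 expf_eq0 (negPf x0) andbF orbF.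
  apply/eqP; apply: (mulfI (expf_neq0 d u0)).
  rewrite mulr0 -e0 (ev_rev_poly u0 sza) (ev_rev_poly u0 szb) invrK.
  by rewrite mulrDr -[in RHS]mulrA.
move=> /ev_basis_free[+ _] => /eqP; rewrite mulf_eq0 expf_eq0 polyX_eq0 orbF.
(* The coefficient of degree [d] of the reversed [a] is [a(0)]. *)
by move/eqP/polyP/(_ d); rewrite coef0 coef_poly ltnSn subnn.
Qed.

Lemma eval_fun_neq0 P B : eval_at P B != 0 -> eval_fun P B != 0.
Proof. by apply: contraNneq => /eval_ker->. Qed.

(** For two presentations of [phi], the cross-multiplied difference is zero as a function, hence
    zero at [P] by [eval_ker]. *)
Lemma has_value_uniq P phi c d :
  has_value P phi c -> has_value P phi d -> c = d.
Proof.
move=> [A [B [B0 -> ->]]] [A' [B' [B'0 e ->]]].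
have := eval_fun_neq0 B0; have := eval_fun_neq0 B'0 => B'F BF.
apply/eqP; rewrite eqr_div // -subr_eq0 -!rmorphM -rmorphB; apply/eqP/eval_ker.
by rewrite rmorphB !rmorphM /=; apply/eqP; rewrite subr_eq0 -eqr_div // e.
Qed.

Lemma has_valueD P phi psi c d : has_value P phi c -> has_value P psi d ->
  has_value P (phi + psi) (c + d).
Proof.
move=> [A [B [B0 -> ->]]] [A' [B' [B'0 -> ->]]].
have := eval_fun_neq0 B0; have := eval_fun_neq0 B'0 => B'F BF.
exists (A * B' + A' * B), (B * B').
by rewrite !rmorphD !rmorphM /= !addf_div // mulf_neq0.
Qed.

Lemma has_valueM P phi psi c d : has_value P phi c -> has_value P psi d ->
  has_value P (phi * psi) (c * d).
Proof.
move=> [A [B [B0 -> ->]]] [A' [B' [B'0 -> ->]]].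
by exists (A * A'), (B * B'); rewrite !rmorphM /= !mulf_div mulf_neq0.
Qed.

Lemma has_value_eval P A : has_value P (eval_fun P A) (eval_at P A).
Proof. by exists A, 1; rewrite eval_fun1 eval_at1 !divr1 oner_neq0. Qed.

Lemma has_value_const P c : has_value P (constF C c) c.
Proof. by have := has_value_eval P c%:P%:P; rewrite eval_funC eval_atC. Qed.

Lemma has_value0 P : has_value P 0 0.
Proof. by have := has_value_const P 0; rewrite rmorph0. Qed.

Lemma has_value1 P : has_value P 1 1.
Proof. by have := has_value_const P 1; rewrite rmorph1. Qed.

Lemma has_valueN P phi c : has_value P phi c -> has_value P (- phi) (- c).
Proof.
move=> h; rewrite -mulN1r -[- c]mulN1r; apply: has_valueM => //.
by have := has_value_const P (-1); rewrite rmorphN1.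
Qed.

Lemma has_valueX P phi c n :
  has_value P phi c -> has_value P (phi ^+ n) (c ^+ n).
Proof.
move=> h; elim: n => [|n IH]; last by rewrite !exprS; apply: has_valueM.
by rewrite !expr0; apply: has_value1.
Qed.

Lemma has_value_ev P s c (p : {poly k}) :
  has_value P s c -> has_value P (ev s p) p.[c].
Proof.
move=> h; elim/poly_ind: p => [|p d IH].
  by rewrite horner0 rmorph0; apply: has_value0.
rewrite rmorphD rmorphM /= evX evC !hornerE.
by apply: has_valueD (has_value_const _ _); apply: has_valueM.
Qed.

Lemma has_valueV P phi c :
  c != 0 -> has_value P phi c -> has_value P phi^-1 c^-1.
Proof.
move=> c0 [A [B [B0 -> cE]]]; exists B, A; rewrite cE !invf_div; split=> //.
by apply: contraNneq c0; rewrite cE => ->; rewrite mul0r.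
Qed.

Lemma has_value_neq0 P phi c : c != 0 -> has_value P phi c -> phi != 0.
Proof.
move=> c0 h; apply: contraNneq c0 => phi0; apply/eqP.
by apply: has_value_uniq h _; rewrite phi0; apply: has_value0.
Qed.

Lemma chart_value1 P : has_value P (chart P).1.1 (chart P).2.1.
Proof. by have := has_value_eval P 'X; rewrite eval_funX eval_atX. Qed.

Lemma chart_value2 P : has_value P (chart P).1.2 (chart P).2.2.
Proof. by have := has_value_eval P 'Y; rewrite eval_funY eval_atY. Qed.

End LocalRing.

(** * Local units, orders and uniformizers *)

Section Orders.
Variables (k : fieldType) (g : nat) (C : hyperelliptic k g).
Local Notation F := (function_field C).
Local Notation f := (hpoly C).
Local Notation x := (xF C).
Local Notation y := (yF C).
Implicit Types (P : point C) (phi psi t : F) (n m : int).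

Lemma local_unitM P phi psi :
  local_unit P phi -> local_unit P psi -> local_unit P (phi * psi).
Proof.
move=> u1 u2; rewrite -[psi]invrK -[psi^-1]mul1r.
by apply: local_unit_div => //; apply: local_unit_div => //; apply: local_unit1.
Qed.

Lemma local_unitV P phi : local_unit P phi -> local_unit P phi^-1.
Proof. by rewrite -[phi^-1]mul1r; apply: local_unit_div (local_unit1 P). Qed.

Lemma local_unitXz P phi n : local_unit P phi -> local_unit P (phi ^ n).
Proof.
have unitX (d : nat) : local_unit P phi -> local_unit P (phi ^+ d).
  move=> u; elim: d => [|d IH]; first exact: local_unit1.
  by rewrite exprS; apply: local_unitM.
by case: n => d u; [apply: unitX | apply/local_unitV/unitX].
Qed.

Lemma local_unit_neq0 P phi : local_unit P phi -> phi != 0.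
Proof. by move=> [c c0] /(has_value_neq0 c0). Qed.

(** The order measured by one fixed parameter, whereas [is_order] quantifies over all uniformizers;
    [is_orderP] compares the two. *)
Definition order_wrt P t phi n := exists2 w, local_unit P w & phi = t ^ n * w.

Lemma order_wrt_unit P t phi : local_unit P phi <-> order_wrt P t phi 0.
Proof.
split=> [u|[w u ->]]; last by rewrite expr0z mul1r.
by exists phi; rewrite ?expr0z ?mul1r.
Qed.

Lemma order_wrt_self P t : order_wrt P t t 1.
Proof. by exists 1; [apply: local_unit1 | rewrite mulr1 expr1z]. Qed.

Lemma order_wrt_neq0 P t phi n : t != 0 -> order_wrt P t phi n -> phi != 0.
Proof.
by move=> t0 [w /local_unit_neq0 w0 ->]; rewrite mulf_neq0 // expfz_neq0.
Qed.

Lemma order_wrtM P t phi psi n m : t != 0 ->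
  order_wrt P t phi n -> order_wrt P t psi m ->
  order_wrt P t (phi * psi) (n + m).
Proof.
move=> t0 [w u ->] [w' u' ->]; exists (w * w'); first exact: local_unitM.
by rewrite expfzDr // mulrACA.
Qed.

Lemma order_wrtV P t phi n : order_wrt P t phi n -> order_wrt P t phi^-1 (- n).
Proof.
move=> [w u ->]; exists w^-1; first exact: local_unitV.
by rewrite invfM invr_expz.
Qed.

Lemma order_wrtX P t phi n (d : nat) : t != 0 ->
  order_wrt P t phi n -> order_wrt P t (phi ^+ d) (n * d%:Z).
Proof.
move=> t0 o; elim: d => [|d IH].
  by rewrite mulr0 expr0; apply/order_wrt_unit/local_unit1.
by rewrite exprS -add1n PoszD mulrDr mulr1; apply: order_wrtM.
Qed.

(** After [t^n] is factored out, the second term carries a positive power of [t], so the cofactor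
    keeps the nonzero value of the first unit. *)
Lemma order_wrtD P t phi psi n m : t != 0 -> has_value P t 0 -> (n < m)%R ->
  order_wrt P t phi n -> order_wrt P t psi m -> order_wrt P t (phi + psi) n.
Proof.
move=> t0 tv nm [w [c c0 wv] ->] [w' [c' _ w'v] ->].
have [d dE] : exists d : nat, m = n + d.+1%:Z by exists `|m - n|.-1%N; lia.
exists (w + t ^+ d.+1 * w'); last first.
  by rewrite dE expfzDr // mulrDr mulrA.
exists c => //; rewrite -[c]addr0; apply: has_valueD => //.
have := has_valueM (has_valueX d.+1 tv) w'v.
by rewrite expr0n mul0r.
Qed.

(** With two different exponents, the unit of the smaller one would be a positive power of [t] times
    a unit and so take the value 0. *)
Lemma order_wrt_uniq P t phi n m : t != 0 -> has_value P t 0 ->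
  order_wrt P t phi n -> order_wrt P t phi m -> n = m.
Proof.
move=> t0 tv; wlog nm : n m / (n < m)%R.
  move=> H on om; have [lt|lt|//] := Order.TotalTheory.ltgtP n m.
    exact: H.
  by apply/esym; apply: H.
move=> [w [c c0 wv] ->] [w' [c' _ w'v]].
have [d ->] : exists d : nat, m = n + d.+1%:Z by exists `|m - n|.-1%N; lia.
rewrite expfzDr // -mulrA => /(mulfI (expfz_neq0 n t0)) wE.
have := has_valueM (has_valueX d.+1 tv) w'v.
rewrite expr0n mul0r -[t ^+ _ * _]wE => wv0.
by rewrite (has_value_uniq wv wv0) eqxx in c0.
Qed.

Lemma uniformizer_value P t : uniformizer P t -> has_value P t 0.
Proof.
move=> ut; apply/(ut t); exists 1; last by rewrite mulr1.
by exists 1; apply: has_value1.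
Qed.

(** Two uniformizers divide each other in the local ring, so their quotient is a unit and can be
    absorbed into the cofactor. *)
Lemma is_orderP P t phi n : uniformizer P t -> t != 0 ->
  is_order P phi n <-> order_wrt P t phi n.
Proof.
move=> ut t0; split; first exact.
move=> [w uw ->] t' ut'.
have [z [c zv] tE] := (ut' t).1 (uniformizer_value ut).
have [z' [c' z'v] t'E] := (ut t').1 (uniformizer_value ut').
have zz : z' * z = 1.
  by apply: (mulfI t0); rewrite mulrA -t'E -tE mulr1.
have cc : c' * c = 1.
  apply: (@has_value_uniq _ _ _ P (z' * z)); first exact: has_valueM.
  by rewrite zz; apply: has_value1.
have uz : local_unit P z.
  exists c => //; apply: contra_eq_neq cc => ->.
  by rewrite mulr0 eq_sym oner_neq0.
exists (z ^ n * w); last by rewrite mulrA -expfzMl -tE.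
by apply: local_unitM => //; apply: local_unitXz.
Qed.

(** The maximal ideal at [P] is generated by the two coordinate functions minus their values, so it
    is enough that [t] lies in it and divides both. *)
Lemma uniformizer_chart P t : has_value P t 0 ->
  (exists2 w, local_ring P w
     & (chart P).1.1 - constF C (chart P).2.1 = t * w) ->
  (exists2 w, local_ring P w
     & (chart P).1.2 - constF C (chart P).2.2 = t * w) ->
  uniformizer P t.
Proof.
move=> tv tX tY phi; split=> [|[w [c wv] ->]]; last first.
  by rewrite /local_ideal -(mul0r c); apply: has_valueM.
(* The polynomials satisfying [near] contain the constants and both variables and are closed under
   sum and product, so they are all polynomials. *)
pose near A := exists2 w, local_ring P w
  & eval_fun P A - constF C (eval_at P A) = t * w.
have nearD A B : near A -> near B -> near (A + B).
  move=> [w [c wv] e] [w' [c' w'v] e']; exists (w + w').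
    by exists (c + c'); apply: has_valueD.
  by rewrite !rmorphD /= opprD addrACA e e' mulrDr.
have nearM A B : near A -> near B -> near (A * B).
  move=> [w [c wv] e] [w' [c' w'v] e'].
  (* From [AB - A(P)B(P) = A (B - B(P)) + B(P) (A - A(P))]. *)
  exists (eval_fun P A * w' + constF C (eval_at P B) * w).
    exists (eval_at P A * c' + eval_at P B * c).
    apply: has_valueD; apply: has_valueM => //; first exact: has_value_eval.
    exact: has_value_const.
  rewrite mulrDr [t * (eval_fun P A * _)]mulrCA -e'.
  rewrite [t * (constF C _ * _)]mulrCA -e !rmorphM /= !mulrBr.
  rewrite [constF C (eval_at P B) * _]mulrC addrA subrK.
  by rewrite [constF C (eval_at P B) * _]mulrC.
have nearC c : near c%:P%:P.
  exists 0; last by rewrite eval_funC eval_atC subrr mulr0.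
  by exists 0; apply: has_value0.
have nearX : near 'X by rewrite /near eval_funX eval_atX.
have nearY : near 'Y by rewrite /near eval_funY eval_atY.
have nearA A : near A.
  elim/poly_ind: A => [|A c IH]; first by rewrite -!polyC0; exact: nearC.
  apply: (nearD _ _ (nearM _ _ IH nearX)).
  elim/poly_ind: c => [|c d IHc]; first by rewrite -!polyC0; exact: nearC.
  by rewrite polyCD polyCM; exact: (nearD _ _ (nearM _ _ IHc nearY) (nearC d)).
move=> [A [B [B0 -> /esym/eqP]]].
rewrite mulf_eq0 invr_eq0 (negPf B0) orbF => /eqP A0.
have [w [c wv] e] := nearA A; rewrite A0 rmorph0 subr0 in e.
exists (w / eval_fun P B); last by rewrite e mulrA.
exists (c / eval_at P B); apply: has_valueM => //; apply: has_valueV => //.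
exact: has_value_eval.
Qed.

(** * Consequences of separability and of characteristic different from 2 *)

Lemma hpoly_neq0 : f != 0.
Proof. by rewrite -size_poly_eq0 hpoly_size. Qed.

Lemma two_neq0 : (2%:R : k) != 0.
Proof. by have := hpoly_char C; rewrite inE /=. Qed.

Lemma yF_neq0 : y != 0.
Proof.
by rewrite -sqrf_eq0 yF_sqr ev_xF_eq0 hpoly_neq0.
Qed.

(** The cofactor takes the value [f'(a)] at [a], which by separability is nonzero at a root of
    [f]. *)
Lemma hpoly_factor a : exists2 h, f = f.[a]%:P + ('X - a%:P) * h
  & root f a -> h.[a] != 0.
Proof.
have : root (f - f.[a]%:P) a by rewrite /root !hornerE subrr.
move=> /factor_theorem[h hE]; have fE : f = f.[a]%:P + ('X - a%:P) * h.
  by rewrite [_ * h]mulrC -hE addrC subrK.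
exists h => //; apply: contraTneq => ha; apply/negP => fa.
have fa' : root f^`() a.
  rewrite /root fE derivD derivC add0r derivM !derivE !hornerE ha.
  by rewrite subrr ?(mul0r, mulr0, addr0).
have := hpoly_separable C; rewrite unlock => /coprimep_root/(_ fa).
by rewrite (eqP fa') eqxx.
Qed.

(** If [g > 0] and [h(0) = 0], the coefficients of [f] in degrees 0 and 1 both vanish, so 0 would be
    a double root of [f]. *)
Lemma special_form_genus (h : {poly k}) :
  f = 'X^(2 * g + 1) + h ^+ 2 -> h.[0] = 0 -> g = 0%N.
Proof.
move=> fE h0; case: (posnP g) => // g0.
have [r rE] : exists r : {poly k}, h = r * ('X - 0%:P).
  by apply/factor_theorem/eqP.
have f1 : f`_1 = 0.
  rewrite fE rE subr0 exprMn coefD coefXn coefMXn addr0.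
  by case: eqP => //; lia.
have f0 : root f 0.
  by rewrite /root fE hornerD hornerXn horner_exp h0 !expr0n addn1 addr0.
have [q qE /(_ f0)] := hpoly_factor 0.
have := congr1 (fun p : {poly k} => p`_1) qE.
rewrite /= subr0 coefD coefC coefXM f1 add0r -horner_coef0 => <-.
by rewrite eqxx.
Qed.

Lemma ev_hpoly_factor a : exists2 h,
  ev x f = constF C f.[a] + (x - constF C a) * ev x h & root f a -> h.[a] != 0.
Proof.
have [h /(congr1 (ev x)) fE hr] := hpoly_factor a; exists h => //.
by rewrite {}fE rmorphD rmorphM rmorphB /= evX !evC.
Qed.

(** * Uniformizers at the affine points *)

Lemma affine_x (Q : affine_point C) : has_value (affine Q) x (val Q).1.
Proof. exact: (chart_value1 (affine Q)). Qed.

Lemma affine_y (Q : affine_point C) : has_value (affine Q) y (val Q).2.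
Proof. exact: (chart_value2 (affine Q)). Qed.

Lemma affine_ev (Q : affine_point C) a b :
  has_value (affine Q) (ev x a + ev x b * y)
    (a.[(val Q).1] + b.[(val Q).1] * (val Q).2).
Proof.
apply: has_valueD; first exact/has_value_ev/affine_x.
by apply: has_valueM (affine_y Q); apply/has_value_ev/affine_x.
Qed.

Lemma local_ring_self P t : exists2 w, local_ring P w & t = t * w.
Proof.
exists 1; last by rewrite mulr1.
by exists 1; apply: has_value1.
Qed.

Lemma xF_sub_neq0 a : x - constF C a != 0.
Proof.
have -> : x - constF C a = ev x ('X - a%:P) by rewrite rmorphB /= evX evC.
by rewrite ev_xF_eq0 polyXsubC_eq0.
Qed.

Lemma affine_x_value (Q : affine_point C) :
  has_value (affine Q) (x - constF C (val Q).1) 0.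
Proof.
rewrite -(subrr (val Q).1); apply: has_valueD; first exact: affine_x.
exact/has_valueN/has_value_const.
Qed.

(** Write [Q = (a, b)]. Then [(y - b)(y + b) = f(x) - f(a)] is divisible by [x - a], and [y + b] is
    a unit because its value [2b] is nonzero. *)
Lemma uniformizer_x (Q : affine_point C) : (val Q).2 != 0 ->
  uniformizer (affine Q) (x - constF C (val Q).1).
Proof.
move=> b0; apply: uniformizer_chart.
- exact: affine_x_value.
- exact: local_ring_self.
rewrite /=; have [h fE _] := ev_hpoly_factor (val Q).1.
have vv : has_value (affine Q) (y + constF C (val Q).2) ((val Q).2 + (val Q).2).
  by apply: has_valueD; [apply: affine_y | apply: has_value_const].
have b2 : (val Q).2 + (val Q).2 != 0.
  by rewrite -mulr2n -mulr_natl mulf_neq0 ?two_neq0.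
exists (ev x h / (y + constF C (val Q).2)).
  exists (h.[(val Q).1] / ((val Q).2 + (val Q).2)); apply: has_valueM.
    exact/has_value_ev/affine_x.
  exact: has_valueV.
apply: (mulIf (has_value_neq0 b2 vv)).
rewrite -mulrA divfK ?(has_value_neq0 b2 vv) //.
rewrite -subr_sqr yF_sqr -rmorphXn /= (eqP (valP Q)).
by rewrite fE addrC addKr.
Qed.

(** At a branch point [y^2 = (x - a) h(x)] with [h(a)] nonzero. *)
Lemma x_sub_root (Q : affine_point C) : (val Q).2 = 0 ->
  exists2 w, local_unit (affine Q) w & x - constF C (val Q).1 = y ^+ 2 * w.
Proof.
move=> b0; have [h fE hr] := ev_hpoly_factor (val Q).1.
have fr : f.[(val Q).1] = 0 by rewrite -(eqP (valP Q)) b0 expr0n.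
have h0 : h.[(val Q).1] != 0 by apply: hr; apply/eqP.
have hv : has_value (affine Q) (ev x h) h.[(val Q).1].
  exact/has_value_ev/affine_x.
exists (ev x h)^-1; first by apply: local_unitV; exists h.[(val Q).1].
rewrite yF_sqr fE fr rmorph0 add0r mulfK //.
exact: has_value_neq0 h0 hv.
Qed.

Lemma uniformizer_y (Q : affine_point C) : (val Q).2 = 0 ->
  uniformizer (affine Q) y.
Proof.
move=> b0; have yv := affine_y Q; rewrite b0 in yv.
apply: uniformizer_chart => //; last first.
  by rewrite /= b0 rmorph0 subr0; apply: local_ring_self.
have [w [c _ wv] e] := x_sub_root b0.
exists (y * w); last by rewrite mulrA -expr2.
by exists (0 * c); apply: has_valueM.
Qed.

Lemma affine_uniformizer (Q : affine_point C) :
  exists2 t, t != 0 & uniformizer (affine Q) t.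
Proof.
have [b0|b0] := eqVneq (val Q).2 0.
  by exists y; [apply: yF_neq0 | apply: uniformizer_y].
by exists (x - constF C (val Q).1); [apply: xF_sub_neq0 | apply: uniformizer_x].
Qed.

(** * Orders at the point at infinity, measured by [v] *)

Local Notation infty := (infinity C).
Local Notation v := (y / x ^+ g.+1).

Lemma vF_neq0 : v != 0.
Proof. by rewrite mulf_neq0 ?yF_neq0 // invr_eq0 expf_neq0 // xF_neq0. Qed.

Lemma infinity_x : has_value infty x^-1 0.
Proof. exact: (chart_value1 infty). Qed.

Lemma infinity_v : has_value infty v 0.
Proof. exact: (chart_value2 infty). Qed.

(** With [u = 1/x], the chart equation says that [v^2] is [u] times the reversed [f], whose value at
    infinity is the leading coefficient 1 of [f]. *)
Lemma xF_order_infinity : order_wrt infty v x (- 2%:Z).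
Proof.
rewrite -[X in order_wrt _ _ X]invrK; apply: order_wrtV.
have hv : has_value infty (ev x^-1 (rev_poly (2 * g + 1) f)) 1.
  have -> : 1 = (rev_poly (2 * g + 1) f).[0].
    rewrite horner_coef0 coef_poly ltn0Sn subn0.
    by have /monicP := hpoly_monic C; rewrite lead_coefE hpoly_size => ->.
  exact/has_value_ev/infinity_x.
exists (ev x^-1 (rev_poly (2 * g + 1) f))^-1.
  by apply: local_unitV; exists 1; rewrite ?oner_neq0.
rewrite -[v ^ _]/(v ^+ 2) (chart_fun_sqr infty) /= rmorphM /= evX mulfK //.
exact: has_value_neq0 (oner_neq0 _) hv.
Qed.

Lemma uniformizer_infinity : uniformizer infty v.
Proof.
apply: uniformizer_chart; first exact: infinity_v.
  rewrite /= rmorph0 subr0.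
  have [w [c _ wv] e] := order_wrtV xF_order_infinity.
  exists (v * w); last by rewrite e mulrA -expr2 opprK.
  by exists (0 * c); apply: has_valueM => //; apply: infinity_v.
by rewrite /= rmorph0 subr0; apply: local_ring_self.
Qed.

(** [a(x)] is [x^(deg a)] times the reversed [a], which takes the value [lead_coef a] at
    infinity. *)
Lemma ev_order_infinity a : a != 0 ->
  order_wrt infty v (ev x a) (- (2 * (size a).-1)%:Z).
Proof.
move=> a0; have sza : size a = (size a).-1.+1 by rewrite prednK ?size_poly_gt0.
rewrite (ev_rev_poly (d := (size a).-1) (xF_neq0 C)) -?sza //.
have -> : - (2 * (size a).-1)%:Z = - 2%:Z * (size a).-1%:Z + 0.
  by rewrite PoszM mulNr addr0.
apply: order_wrtM; first exact: vF_neq0.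
  by apply: order_wrtX; [apply: vF_neq0 | apply: xF_order_infinity].
apply/order_wrt_unit; exists (lead_coef a); first by rewrite lead_coef_eq0.
have -> : lead_coef a = (rev_poly (size a).-1 a).[0].
  by rewrite horner_coef0 coef_poly ltn0Sn subn0.
exact/has_value_ev/infinity_x.
Qed.

Lemma yF_order_infinity : order_wrt infty v y (- (2 * g + 1)%:Z).
Proof.
have -> : - (2 * g + 1)%:Z = 1 + - 2%:Z * g.+1%:Z by lia.
have {2}-> : y = v * x ^+ g.+1 by rewrite divfK // expf_neq0 // xF_neq0.
apply: order_wrtM; first exact: vF_neq0.
  exact: order_wrt_self.
by apply: order_wrtX; [apply: vF_neq0 | apply: xF_order_infinity].
Qed.

(* The two summands never have the same order, since one order is even and the
   other is odd. *)
Lemma order_infinity a b : b != 0 -> order_wrt infty v (ev x a + ev x b * y)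
  (- (maxn (2 * (size a).-1) (2 * (size b).-1 + (2 * g + 1)))%:Z).
Proof.
move=> b0.
have ob : order_wrt infty v (ev x b * y) (- (2 * (size b).-1 + (2 * g + 1))%:Z).
  rewrite PoszD opprD; apply: order_wrtM; first exact: vF_neq0.
    exact: ev_order_infinity.
  exact: yF_order_infinity.
have [->|a0] := eqVneq a 0.
  by rewrite rmorph0 add0r size_poly0 max0n.
have oa := ev_order_infinity a0.
case: (ltnP (2 * (size a).-1) (2 * (size b).-1 + (2 * g + 1))) => ab.
  rewrite addrC; apply: order_wrtD ob oa; [exact: vF_neq0|exact: infinity_v|].
  by lia.
apply: order_wrtD oa ob; [exact: vF_neq0|exact: infinity_v|].
by lia.
Qed.

End Orders.

(** * Functions regular on the affine curve, and principal divisors *)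

Section ClosedField.
Variables (K : closedFieldType) (g : nat) (C : hyperelliptic K g).
Local Notation F := (function_field C).
Local Notation f := (hpoly C).
Local Notation x := (xF C).
Local Notation y := (yF C).
Local Notation infty := (infinity C).
Local Notation v := (y / x ^+ g.+1).
Implicit Types (phi : F) (Q R : affine_point C).

Lemma exists_sqrt (c : K) : exists b, b ^+ 2 = c.
Proof.
have sz : size ('X^2 - c%:P : {poly K}) != 1.
  rewrite size_polyDl size_polyXn // size_polyN.
  by rewrite (leq_ltn_trans (size_polyC_leq1 _)).
have [b] := closed_rootP _ sz; rewrite /root !hornerE subr_eq0 => /eqP <-.
by exists b.
Qed.

Lemma poly_factor (p : {poly K}) a :
  p.[a] = 0 -> exists q : {poly K}, p = q * ('X - a%:P).
Proof. by move=> /eqP/factor_theorem. Qed.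

(* A zero [a] of the denominator is a common zero of both numerators: when [a]
   is not a root of f this is read off from the two points above [a], and at a
   branch point [y] is a uniformizer, so that [b * y] cannot be divisible by
   [x - a] unless [b] vanishes at [a]. *)
Lemma regular_denominator phi a (d a1 b1 : {poly K}) :
  (forall Q, local_ring (affine Q) phi) ->
  phi * ev x (d * ('X - a%:P)) = ev x a1 + ev x b1 * y ->
  exists a2 b2, phi * ev x d = ev x a2 + ev x b2 * y.
Proof.
move=> reg phiE; have [b bE] := exists_sqrt f.[a].
have vanish Q : (val Q).1 = a -> a1.[a] + b1.[a] * (val Q).2 = 0.
  move=> Qa; have [c cv] := reg Q; have := affine_ev Q a1 b1.
  have := has_valueM cv (has_value_ev (d * ('X - a%:P)) (affine_x Q)).
  rewrite phiE hornerM hornerXsubC Qa subrr !mulr0 => v1 v2.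
  exact: has_value_uniq v2 v1.
have Qpf : (a, b).2 ^+ 2 == f.[(a, b).1] by rewrite /= bE.
have Rpf : (a, - b).2 ^+ 2 == f.[(a, - b).1] by rewrite /= sqrrN bE.
pose Q : affine_point C := exist _ (a, b) Qpf.
pose R : affine_point C := exist _ (a, - b) Rpf.
have vQ : a1.[a] + b1.[a] * b = 0 by apply: (vanish Q).
have vR : a1.[a] - b1.[a] * b = 0 by rewrite -mulrN; apply: (vanish R).
have a1a : a1.[a] = 0.
  apply/eqP; have := congr2 +%R vQ vR; rewrite addrACA subrr !addr0 => /eqP.
  by rewrite -mulr2n -mulr_natl mulf_eq0 (negPf (two_neq0 C)).
have [a2 a2E] := poly_factor a1a.
have b1a : b1.[a] = 0.
  apply/eqP; have [b0|b0] := eqVneq b 0; last first.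
    by move/eqP: vQ; rewrite a1a add0r mulf_eq0 (negPf b0) orbF.
  have [h fE hr] := ev_hpoly_factor C a.
  have fa : f.[a] = 0 by rewrite -bE b0 expr0n.
  have ha : h.[a] != 0 by apply: hr; apply/eqP.
  rewrite fa rmorph0 add0r in fE.
  (* The relation for [b1 y] is multiplied by [y], and the factor [x - a] common to [y^2], [a1] and
     the denominator is cancelled. The right side visibly vanishes at [Q], which forces
     [b1(a) h(a) = 0]. *)
  have bhE : ev x (b1 * h) = (phi * ev x d - ev x a2) * y.
    apply: (mulfI (xF_sub_neq0 C a)).
    transitivity (ev x b1 * y * y).
      by rewrite -mulrA -expr2 yF_sqr fE rmorphM /= mulrCA.
    rewrite [RHS]mulrA; congr (_ * _); apply: (addrI (ev x a1)).
    rewrite -phiE a2E !rmorphM rmorphB /= evX evC.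
    by rewrite [(x - _) * _]mulrC mulrBl [RHS]addrC subrK mulrA.
  have [c cv] := reg Q.
  have dv := has_value_ev d (affine_x Q).
  have a2v := has_valueN (has_value_ev a2 (affine_x Q)).
  have := has_valueM (has_valueD (has_valueM cv dv) a2v) (affine_y Q).
  rewrite -bhE /= b0 mulr0 => v0.
  have := has_value_uniq v0 (has_value_ev _ (affine_x Q)).
  by rewrite hornerM /= => /esym/eqP; rewrite mulf_eq0 (negPf ha) orbF.
have [b2 b2E] := poly_factor b1a; exists a2, b2.
apply: (mulIf (xF_sub_neq0 C a)).
have sub : x - constF C a = ev x ('X - a%:P) by rewrite rmorphB /= evX evC.
rewrite sub -mulrA -rmorphM phiE a2E b2E !rmorphM /= mulrDl.
by rewrite [RHS in _ + RHS]mulrAC.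
Qed.

(** Induction on the degree of a common denominator: [regular_denominator] removes one linear factor
    at a time, until a constant is left and can be inverted. *)
Lemma regular_poly phi : (forall Q, local_ring (affine Q) phi) ->
  exists a b, phi = ev x a + ev x b * y.
Proof.
move=> reg; have [d [a [b [d0 phiE]]]] := common_denominator phi.
have [n] := ubnP (size d); elim: n => // n IH in d a b d0 phiE *.
rewrite ltnS => szd; have [/size_poly1P[c c0 dE]|sz1] := boolP (size d == 1).
  exists (c^-1%:P * a), (c^-1%:P * b).
  have cF0 : constF C c != 0 by rewrite fmorph_eq0.
  apply: (mulfI cF0); rewrite mulrC -(evC x) -dE phiE !rmorphM /= !evC dE evC.
  by rewrite fmorphV mulrDr !mulrA mulfV // !mul1r.
have [r rd] := closed_rootP _ sz1; have [q dE] := poly_factor (eqP rd).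
have q0 : q != 0 by apply: contraNneq d0; rewrite dE => ->; rewrite mul0r.
have [a2 [b2 e2]] : exists a2 b2, phi * ev x q = ev x a2 + ev x b2 * y.
  by apply: (regular_denominator (a := r) (a1 := a) (b1 := b) reg); rewrite -dE.
apply: (IH _ _ _ q0 e2); move: szd.
by rewrite dE size_Mmonic ?monicXsubC // size_XsubC addn2.
Qed.

Lemma torsionP (P : point C) n : abel_jacobi P *+ n = 0 <->
  exists2 phi, phi != 0 & forall S : point C,
    is_order S phi ((P == S)%:R *+ n - (infty == S)%:R *+ n).
Proof.
have coefE S : coeff S (val (Divisor0 (pt_sub_infinity_degree0 P) *+ n)) =
    (P == S)%:R *+ n - (infty == S)%:R *+ n.
  by rewrite raddfMn coeffMn /= coeffB !coeffU !mul1r mulrnBl.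
have prE : (Divisor0 (pt_sub_infinity_degree0 P) *+ n \in @principal K g C) =
    (abel_jacobi P *+ n == 0).
  rewrite -[X in X \in _]subr0 Quotient.idealrBE /abel_jacobi.
  by rewrite !raddfMn raddf0.
split=> [/eqP|[phi phi0 o]].
  by rewrite -prE => /asboolP[phi phi0 o]; exists phi => // S; rewrite -coefE.
by apply/eqP; rewrite -prE; apply/asboolP; exists phi => // S; rewrite coefE.
Qed.

End ClosedField.

(** * Torsion points on the curve over an algebraically closed field *)

Section Torsion.
Variables (K : closedFieldType) (g : nat) (C : hyperelliptic K g).
Local Notation F := (function_field C).
Local Notation f := (hpoly C).
Local Notation x := (xF C).
Local Notation y := (yF C).
Local Notation infty := (infinity C).
Local Notation v := (y / x ^+ g.+1).
Implicit Types (phi : F) (Q R : affine_point C).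

Lemma affine_pointP Q : (val Q).2 ^+ 2 = f.[(val Q).1].
Proof. exact/eqP/(valP Q). Qed.

Lemma affine_point_inj Q R :
  (val Q).1 = (val R).1 -> (val Q).2 = (val R).2 -> Q = R.
Proof.
case: Q R => [[a b] p] [[c d] q] /= e1 e2; apply: val_inj => /=.
by rewrite e1 e2.
Qed.

(** A working form of [torsionP]: order 0 becomes being a local unit, and at infinity it is enough
    to test the uniformizer [v]. *)
Lemma affine_torsionP Q n : abel_jacobi (affine Q) *+ n = 0 <->
  exists phi, [/\ phi != 0, is_order (affine Q) phi n%:Z,
    forall R, R != Q -> local_unit (affine R) phi
    & order_wrt infty v phi (- n%:Z)].
Proof.
have unitP R phi : local_unit (affine R) phi <-> is_order (affine R) phi 0.
  have [t t0 ut] := affine_uniformizer R.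
  by rewrite (is_orderP _ _ ut t0); apply: order_wrt_unit.
have inftyP := is_orderP _ _ (@uniformizer_infinity K g C) (vF_neq0 C).
split=> [/torsionP[phi phi0 o]|[phi [phi0 oQ oR oi]]].
  exists phi; split=> // [|R RQ|].
  - by have := o (affine Q); rewrite eqxx /= mul0rn subr0 natz.
  - apply/unitP; have := o (affine R).
    have /negPf-> : affine Q != affine R.
      by apply: contraNneq RQ => -[->].
    by rewrite !mul0rn subrr.
  - by apply/inftyP; have := o infty; rewrite eqxx /= mul0rn sub0r natz.
apply/torsionP; exists phi => // -[R|].
  rewrite /= mul0rn subr0; have [<-|RQ] := eqVneq Q R.
    by rewrite eqxx natz.
  have /negPf-> : affine Q != affine R by apply: contraNneq RQ => -[->].
  by rewrite mul0rn; apply/unitP/oR; rewrite eq_sym.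
by rewrite eqxx /= mul0rn sub0r natz; apply/inftyP.
Qed.

Lemma torsion_poly Q n : (0 < n)%N -> abel_jacobi (affine Q) *+ n = 0 ->
  exists a b : {poly K},
    (forall R, a.[(val R).1] + b.[(val R).1] * (val R).2 = 0 <-> R = Q) /\
    order_wrt infty v (ev x a + ev x b * y) (- n%:Z).
Proof.
move=> n0 /affine_torsionP[phi [phi0 oQ oR oi]].
have vQ : has_value (affine Q) phi 0.
  have [t t0 ut] := affine_uniformizer Q.
  have [w [c _ wv] ->] := oQ t ut; rewrite -[t ^ _]/(t ^+ n).
  have := has_valueM (has_valueX n (uniformizer_value ut)) wv.
  by rewrite expr0n eqn0Ngt n0 mul0r.
have [|a [b phiE]] := @regular_poly K g C phi.
  move=> R; have [->|/oR[c _ cv]] := eqVneq R Q; first by exists 0.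
  by exists c.
exists a, b; split=> [R|]; last by rewrite -phiE.
have := affine_ev R a b; rewrite -phiE => vR.
split=> [v0|RQ]; last by move: vR; rewrite RQ => /(has_value_uniq vQ).
apply/eqP; apply: contraT => /oR[c c0 cv].
by rewrite -(has_value_uniq vR cv) v0 eqxx in c0.
Qed.

(** The function [x - x(Q)] has divisor [2 Q - 2 oo]. *)
Lemma branch_torsion Q : (val Q).2 = 0 -> abel_jacobi (affine Q) *+ 2 = 0.
Proof.
move=> b0; apply/affine_torsionP; exists (x - constF C (val Q).1).
have xE : x - constF C (val Q).1 = ev x ('X - (val Q).1%:P).
  by rewrite rmorphB /= evX evC.
split; first exact: xF_sub_neq0.
- by apply/(is_orderP _ _ (uniformizer_y b0) (yF_neq0 C))/x_sub_root.
- move=> R RQ; exists ((val R).1 - (val Q).1).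
    rewrite subr_eq0; apply: contra RQ => /eqP Rx; apply/eqP.
    (* A point with the same [x] has [y^2 = f(x(Q)) = 0], hence is [Q]. *)
    apply: affine_point_inj => //; rewrite b0; apply/eqP.
    by rewrite -sqrf_eq0 affine_pointP Rx -affine_pointP b0 expr0n.
  by apply: has_valueD; [apply: affine_x | apply/has_valueN/has_value_const].
have := @ev_order_infinity _ _ C ('X - (val Q).1%:P).
by rewrite polyXsubC_eq0 -xE size_XsubC => /(_ isT).
Qed.

Lemma torsion_bound Q n : has_order (abel_jacobi (affine Q)) n ->
  n = 2%N \/ (2 * g + 1 <= n)%N.
Proof.
move=> [n0 nQ nmin]; case: (leqP (2 * g + 1) n) => ng; first by right.
left; have [a [b [zero o]]] := torsion_poly n0 nQ.
have uniq m := order_wrt_uniq (m := m) (vF_neq0 C) (infinity_v C) o.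
have [b0|b0] := eqVneq b 0; last first.
  (* A nonzero [b] would give a pole of order at least [2g + 1]. *)
  by have := uniq _ (order_infinity C a b0); lia.
have Ea : ev x a + ev x b * y = ev x a by rewrite b0 rmorph0 mul0r addr0.
have a0 : a != 0.
  by have := order_wrt_neq0 (vF_neq0 C) o; rewrite Ea ev_xF_eq0.
have nE : n = (2 * (size a).-1)%N.
  by rewrite Ea in uniq; have [] := oppr_inj (uniq _ (ev_order_infinity C a0)).
have aQ : a.[(val Q).1] = 0.
  by have := (zero Q).2 erefl; rewrite b0 horner0 mul0r addr0.
pose q := ((val Q).1, - (val Q).2).
have conj_pf : q.2 ^+ 2 == f.[q.1].
  by rewrite /= sqrrN; apply: (valP Q).
(* As [b = 0], vanishing depends on the [x]-coordinate only, so the conjugate point is a zero as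
   well. *)
have conjQ : exist _ q conj_pf = Q :> affine_point C.
  by apply/zero; rewrite /= aQ b0 horner0 mul0r addr0.
have y0 : (val Q).2 = 0.
  have := congr1 (fun R : affine_point C => (val R).2) conjQ => /= /eqP.
  rewrite eq_sym -addr_eq0 -mulr2n -mulr_natl mulf_eq0 (negPf (two_neq0 C)).
  by move/eqP.
(* The order is positive, even by [nE], and at most 2 by minimality. *)
by have := nmin 2%N isT (branch_torsion y0); lia.
Qed.

Lemma monic_single_root (p : {poly K}) n : p \is monic -> size p = n.+1 ->
  (forall r, p.[r] = 0 -> r = 0) -> p = 'X^n.
Proof.
move=> pm szp pr; have [s pE] := closed_field_poly_normal p.
rewrite (monicP pm) scale1r in pE.
have s0 : {in s, forall z, z = 0}.
  move=> z zs; apply: pr; apply/eqP.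
  by rewrite pE -/(root _ z) root_prod_XsubC.
have -> : n = size s by move: szp; rewrite {1}pE size_prod_XsubC => -[].
rewrite pE big_seq (eq_bigr (fun=> 'X)); last first.
  by move=> z /s0->; rewrite subr0.
by rewrite -big_seq big_const_seq count_predT iter_mulr_1.
Qed.

Lemma maximal_torsion_form Q : (val Q).1 = 0 ->
  abel_jacobi (affine Q) *+ (2 * g + 1) = 0 ->
  exists h : {poly K}, [/\ (size h <= g.+1)%N,
    f = 'X^(2 * g + 1) + h ^+ 2 & h.[0] = (val Q).2].
Proof.
move=> Q0 tQ; have [|a [b [zero o]]] := torsion_poly _ tQ; first by lia.
have uniq m := order_wrt_uniq (m := m) (vF_neq0 C) (infinity_v C) o.
have b0 : b != 0.
  apply/eqP => b0.
  have Ea : ev x a + ev x b * y = ev x a by rewrite b0 rmorph0 mul0r addr0.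
  have a0 : a != 0.
    by have := order_wrt_neq0 (vF_neq0 C) o; rewrite Ea ev_xF_eq0.
  (* Without [b] the pole order is even, whereas [2g + 1] is odd. *)
  by rewrite Ea in uniq; have := uniq _ (ev_order_infinity C a0); lia.
have [nE] := oppr_inj (uniq _ (order_infinity C a b0)).
have szb : (0 < size b)%N by rewrite size_poly_gt0.
have [sb sa] : size b = 1%N /\ (size a <= g.+1)%N.
  by move: nE szb; move: (size a) (size b) => m n; lia.
have [c c0 bE] : exists2 c, c != 0 & b = c%:P by apply/size_poly1P/eqP.
(* Chosen so that [a + c y = c (y - h)]. *)
pose h := - (c^-1 *: a).
have sh : (size h <= g.+1)%N.
  by rewrite size_polyN (leq_trans (size_scale_leq _ _)).
have zeroh R : (val R).2 = h.[(val R).1] <-> R = Q.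
  rewrite -zero bE hornerC /h hornerN hornerZ.
  split=> [->|]; first by rewrite mulrN mulrA mulfV // mul1r subrr.
  move=> /eqP; rewrite addrC addr_eq0 => /eqP e.
  by rewrite -mulrN -e mulrA mulVf // mul1r.
exists h; split=> //; last first.
  by apply/esym; have := (zeroh Q).2 erefl; rewrite Q0.
(* Since [deg h^2 <= 2g], subtracting it keeps [f] monic of degree [2g + 1]. *)
have sh2 : (size (- h ^+ 2) < size f)%N.
  rewrite size_polyN hpoly_size (leq_ltn_trans (size_poly_exp_leq _ _)) //.
  lia.
have -> : 'X^(2 * g + 1) = f - h ^+ 2; last by rewrite subrK.
apply/esym/monic_single_root.
- by rewrite monicE lead_coefDl // -monicE hpoly_monic.
- by rewrite size_polyDl // hpoly_size.
move=> r /eqP; rewrite hornerD hornerN horner_exp subr_eq0 => /eqP fr.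
have Rpf : (r, h.[r]).2 ^+ 2 == f.[(r, h.[r]).1] by rewrite /= fr.
have RQ : exist _ (r, h.[r]) Rpf = Q :> affine_point C by apply/zeroh.
by move: Q0; rewrite -RQ.
Qed.

Lemma special_form_torsion (h : {poly K}) Q : (size h <= g.+1)%N ->
  f = 'X^(2 * g + 1) + h ^+ 2 -> val Q = (0, h.[0]) ->
  abel_jacobi (affine Q) *+ (2 * g + 1) = 0.
Proof.
move=> sh fE Q0; apply/affine_torsionP; exists (ev x (- h) + ev x 1 * y).
have o := order_infinity C (- h) (oner_neq0 _).
have {}o : order_wrt infty v (ev x (- h) + ev x 1 * y) (- (2 * g + 1)%:Z).
  congr (order_wrt _ _ _ (- _%:Z)): o; rewrite size_polyN size_poly1.
  by move: sh; move: (size h) => m; lia.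
(* The function is [y - h], in the shape required by [order_infinity]; its product with the
   conjugate [y + h] is [y^2 - h^2], up to sign the norm. *)
have prodE : (ev x (- h) + ev x 1 * y) * (y + ev x h) = x ^+ (2 * g + 1).
  rewrite rmorph1 mul1r rmorphN /= [- _ + y]addrC -subr_sqr yF_sqr fE.
  by rewrite rmorphD !rmorphXn /= evX addrK.
split=> //.
- apply/eqP => e; move/eqP: prodE; rewrite e mul0r eq_sym expf_eq0.
  by rewrite (negPf (xF_neq0 C)) andbF.
- have Qx : (val Q).1 = 0 by rewrite Q0.
  have Qy : (val Q).2 = h.[0] by rewrite Q0.
  (* If [h(0) = 0], then [g = 0], so [h = 0] and the function is the uniformizer [y]. Otherwise [x]
     is a uniformizer at [Q], and [y + h] is a unit with value [2 h(0)]. *)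
  have [h0|h0] := eqVneq h.[0] 0.
    have g0 := special_form_genus fE h0.
    have hE : h = 0.
      rewrite g0 in sh; rewrite (size1_polyC sh) -horner_coef0 h0 //.
    rewrite hE oppr0 rmorph0 add0r rmorph1 mul1r.
    have -> : (2 * g + 1)%N = 1%N by rewrite g0.
    apply/(is_orderP _ _ (uniformizer_y _) (yF_neq0 C)); first by rewrite Qy.
    exact: order_wrt_self.
  have yh : has_value (affine Q) (y + ev x h) (h.[0] + h.[0]).
    apply: has_valueD; first by rewrite -Qy; apply: affine_y.
    by have := has_value_ev h (affine_x Q); rewrite Qx.
  have hh0 : h.[0] + h.[0] != 0.
    by rewrite -mulr2n -mulr_natl mulf_neq0 // (two_neq0 C).
  have ux := uniformizer_x (_ : (val Q).2 != 0); rewrite Qy in ux.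
  have {ux} := ux h0; rewrite Qx rmorph0 subr0 => ux.
  apply/(is_orderP _ _ ux (xF_neq0 C)).
  exists (y + ev x h)^-1.
    by apply: local_unitV; exists (h.[0] + h.[0]).
  by rewrite -[x ^ _]/(x ^+ _) -prodE mulfK // (has_value_neq0 hh0 yh).
- move=> R RQ.
  exists ((- h).[(val R).1] + (1 : {poly K}).[(val R).1] * (val R).2).
    (* A zero of [y - h] satisfies [x^(2g+1) = f - h^2 = 0], hence equals [(0, h(0))]. *)
    apply: contra RQ; rewrite hornerN hornerC mul1r addrC subr_eq0 => /eqP Ry.
    have fz z : f.[z] = z ^+ (2 * g + 1) + h.[z] ^+ 2.
      by rewrite fE hornerD hornerXn horner_exp.
    have /eqP := affine_pointP R; rewrite Ry fz eq_sym -subr_eq0 addrK expf_eq0.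
    case/andP=> _ /eqP Rx; apply/eqP/affine_point_inj; rewrite Q0 //=.
    by rewrite Ry Rx.
  exact: affine_ev.
Qed.

End Torsion.

(** * Descent of a polynomial square root to the ground field *)

Section SquareRootDescent.
Variables (k K : fieldType) (iota : {rmorphism k -> K}).

(* Hensel lifting: each coefficient of [h] is determined by the previous ones
   through a linear equation with coefficient [2 h(0)]. *)
Lemma sqrt_poly_descent (p : {poly k}) (h : {poly K}) (c : k) :
  (2%:R : k) != 0 -> c != 0 -> h.[0] = iota c -> map_poly iota p = h ^+ 2 ->
  exists q : {poly k}, h = map_poly iota q.
Proof.
move=> two0 c0 h0 pE.
have lift n : exists (q : {poly k}) (r : {poly K}),
    q.[0] = c /\ h = map_poly iota q + 'X^(n.+1) * r.
  elim: n => [|n [q [r [q0 hE]]]].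
    have : root (h - (iota c)%:P) 0 by rewrite /root !hornerE h0 subrr.
    move=> /factor_theorem[r rE]; exists c%:P, r; rewrite hornerC; split=> //.
    by rewrite map_polyC /= expr1 mulrC -['X]subr0 -polyC0 -rE addrC subrK.
  have [r' rE] : exists r' : {poly K}, r = (r.[0])%:P + 'X * r'.
    have : root (r - (r.[0])%:P) 0 by rewrite /root !hornerE subrr.
    move=> /factor_theorem[r' r'E]; exists r'.
    by rewrite mulrC -['X]subr0 -polyC0 -r'E addrC subrK.
  (* In the square of [q + X^(n+1) r], the unknown part contributes only [2 q(0) r(0)] in degree
     [n + 1]. *)
  have coefE : iota p`_n.+1 = iota (q ^+ 2)`_n.+1 + 2%:R * iota c * r.[0].
    have := congr1 (fun s : {poly K} => s`_n.+1) pE.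
    rewrite /= coef_map /= => ->.
    have -> : h ^+ 2 = map_poly iota (q ^+ 2)
        + 'X^(n.+1) * (2%:R%:P * map_poly iota q * r + 'X^(n.+1) * r ^+ 2).
      by rewrite hE rmorphXn /= polyC_natr; ring.
    rewrite coefD coef_map /= coefXnM ltnn subnn; congr (_ + _).
    have mq0 : (map_poly iota q).[0] = iota c.
      by rewrite -(rmorph0 iota) horner_map q0.
    rewrite -horner_coef0 hornerD !hornerM hornerC hornerXn mq0.
    by rewrite expr0n mul0r addr0.
  pose e := (p`_n.+1 - (q ^+ 2)`_n.+1) / (2%:R * c).
  have eE : r.[0] = iota e.
    rewrite /e fmorph_div rmorphB rmorphM rmorph_nat coefE addrC addKr.
    by rewrite mulrC mulKf // -(rmorph_nat iota) -rmorphM fmorph_eq0 mulf_neq0.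
  exists (q + e *: 'X^(n.+1)), r'; split.
    by rewrite !hornerE q0 expr0n mulr0 addr0.
  rewrite hE {1}rE rmorphD /= map_polyZ map_polyXn /= -eE.
  by rewrite -mul_polyC [_%:P * _]mulrC mulrDr addrA mulrA -exprSr.
have [q [r [_ hE]]] := lift (size h).
(* The approximation [q] agrees with [h] below degree [size h + 1]; truncation discards whatever [q]
   has beyond. *)
exists (take_poly (size h).+1 q); apply/polyP => i.
rewrite coef_map coef_poly; case: ltnP => ih; last first.
  by rewrite [RHS]rmorph0; apply/nth_default/ltnW.
by rewrite {1}hE coefD coefXnM ih addr0 coef_map.
Qed.

End SquareRootDescent.

(** Points are rational over [k], but their classes are taken in [J(K)] for an algebraically closed
    [K]; since [J(k)] embeds in [J(K)], orders do not change. *)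
Theorem lemma1p1 (k : fieldType) (g : nat) (C : hyperelliptic k g)
    (K : closedFieldType) (iota : {rmorphism k -> K}) :
  let i (P : point C) : jacobian (base_change iota C) :=
    abel_jacobi (base_change_point iota P) in
  [/\ forall (P : point C) (n : nat),
        P <> infinity C -> has_order (i P) n ->
        n = 2%N \/ (2 * g + 1 <= n)%N,
      forall Q : affine_point C,
        has_order (i (affine Q)) (2 * g + 1) -> (val Q).1 = 0 ->
        exists h : {poly k},
          [/\ (size h <= g.+1)%N,
              hpoly C = 'X^(2 * g + 1) + h ^+ 2
            & val Q = (0, h.[0])]
    & forall h : {poly k},
        (size h <= g.+1)%N ->
        hpoly C = 'X^(2 * g + 1) + h ^+ 2 ->
        forall Q : affine_point C, val Q = (0, h.[0]) ->
        has_order (i (affine Q)) (2 * g + 1)].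
Proof.
move=> i; split=> [[Q|] n // _|Q [_ tQ _] Q0|h sh fE Q Q0].
- exact: torsion_bound.
- have [|h [sh fE hQ]] := maximal_torsion_form _ tQ.
    by rewrite /= Q0 rmorph0.
  rewrite /= in fE hQ.
  have [q hE] : exists q, h = map_poly iota q.
    (* Lifting coefficients needs [h(0)] nonzero; if it is zero, then [g = 0] and [h] is the zero
       polynomial. *)
    have [y0|y0] := eqVneq (val Q).2 0.
      have h0 : h.[0] = 0 by rewrite hQ y0 rmorph0.
      have g0 := special_form_genus (C := base_change iota C) fE h0.
      rewrite g0 in sh; exists 0.
      by rewrite rmorph0 (size1_polyC sh) -horner_coef0 h0.
    apply: (sqrt_poly_descent (p := hpoly C - 'X^(2 * g + 1)) _ y0 hQ).
      exact: (two_neq0 C).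
    by rewrite rmorphB /= map_polyXn fE addrC addKr.
  exists q; split; first by rewrite hE size_map_poly in sh.
    apply: (map_poly_inj iota).
    by rewrite rmorphD /= map_polyXn rmorphXn /= -hE.
  have qQ : (val Q).2 = q.[0].
    by apply: (fmorph_inj iota); rewrite -hQ hE -horner_map rmorph0.
  by move: Q0 qQ; case: (val Q) => a b /= -> ->.
have t : i (affine Q) *+ (2 * g + 1) = 0.
  apply: (special_form_torsion (h := map_poly iota h)).
  - by rewrite size_map_poly.
  - by rewrite /= fE rmorphD /= map_polyXn rmorphXn.
  - by rewrite /= Q0 /= rmorph0 -horner_map rmorph0.
(* The class is killed by [2g + 1], so it has an order [m <= 2g + 1], and [torsion_bound] leaves
   [m = 2] or [m = 2g + 1]. *)
have ex : exists n, (0 < n)%N && (i (affine Q) *+ n == 0).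
  by exists (2 * g + 1)%N; rewrite t eqxx addn1.
have [m /andP[m0 /eqP tm] mmin] := ex_minnP ex.
have om : has_order (i (affine Q)) m.
  by split=> // n n0 tn; apply: mmin; rewrite n0 tn eqxx.
have le_m : (m <= 2 * g + 1)%N by apply: mmin; rewrite t eqxx addn1.
have [m2|ge_m] := torsion_bound om; last first.
  by have -> : (2 * g + 1)%N = m by lia.
(* If [m = 2], the class is killed by both 2 and the odd number [2g + 1], hence is zero, against the
   minimality of [m]. *)
have t1 : i (affine Q) *+ 1 = 0.
  move: t; rewrite mulrnDr mulnC mulrnA.
  by rewrite -mulrnA -m2 mulnC mulrnA tm mul0rn add0r.
by have := mmin 1%N; rewrite t1 eqxx m2 => /(_ isT).
Qed.
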